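(* Let $C(\mathbb{R})$ be the space of all continuous real-valued functions on $\mathbb{R}$ with the topology defined by the collection $\|x\|_k=\max_{t\in[-k,k]}|x(t)|$, $k=0,1,2,\dots$, and let $Y$ be a real linear topological space. Then every bounded-differentiable germ at $0\in C(\mathbb{R})$ into $Y$ has a global bounded-differentiable representative, and every compact-differentiable germ at $0\in C(\mathbb{R})$ into $Y$ has a global compact-differentiable representative.
   Context: Differentiability. A map $f$ from a neighborhood of $x$ in a linear topological space $X$ to a linear topological space $Y$ is differentiable at $x$ if there is a continuous linear $A:X\to Y$ such that, with $r(h)=f(x+h)-f(x)-Ah$: (i) bounded differentiability: for every bounded set $S\subset X$ (bounded in the sense of linear topological spaces), $r(th)/t\to 0$ as $t\to 0$ ($t\in\mathbb{R}$), uniformly in $h\in S$; (ii) compact (Hadamard) differentiability: $f(x+t_nh_n)-f(x)=t_nAh+o(t_n)$ whenever $t_n\to 0$ in $\mathbb{R}$ and $h_n\to h$ in $X$. A map is differentiable on a set if it is differentiable at every point of it. Germs. A germ at $0\in X$ into $Y$ is an equivalence class of maps into $Y$ defined on neighborhoods of $0$, any two of which coincide on some neighborhood of $0$; its elements are called representatives. A germ is differentiable (in a given sense) if it has a representative differentiable in that sense on a neighborhood of $0$. A global differentiable representative is a representative defined and differentiable (in that sense) on all of $X$. *)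

(* Defs.v *)
From HB Require Import structures.
From mathcomp Require Import all_boot all_order all_algebra.
From mathcomp Require Import all_classical all_reals all_analysis.

Set Implicit Arguments.
Unset Strict Implicit.
Unset Printing Implicit Defensive.

Import Order.TTheory GRing.Theory Num.Theory.
Import numFieldNormedType.Exports.

Local Open Scope classical_set_scope.
Local Open Scope ring_scope.

Section Differentiability.
Context {R : realType} {X Y : topologicalLmodType R}.

Definition tvs_bounded (S : set X) : Prop :=
  forall V : set X, nbhs 0 V -> \forall t \near +oo, S `<=` ( *:%R t) @` V.

Definition remainder (f A : X -> Y) (x h : X) : Y := f (x + h) - f x - A h.

(* Both notions only depend on the values of [f] near [x], so they apply to a
   map defined on a neighborhood of [x], extended arbitrarily to [X].  [Y] need
   not be Hausdorff. *)
Definition bounded_differentiable_at (f : X -> Y) (x : X) : Prop :=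
  exists A : {linear X -> Y}, continuous A /\
    forall S : set X, tvs_bounded S -> forall V : set Y, nbhs 0 V ->
      \forall t \near (0 : R)^',
        forall h, S h -> V (t^-1 *: remainder f A x (t *: h)).

(* The terms [t n] may vanish: the increment is then 0, and so is the quotient
   since [0^-1 = 0]. *)
Definition compact_differentiable_at (f : X -> Y) (x : X) : Prop :=
  exists A : {linear X -> Y}, continuous A /\
    forall (t : nat -> R) (h : nat -> X) (h0 : X),
      t @ \oo --> (0 : R) -> h @ \oo --> h0 ->
      (fun n => (t n)^-1 *: (f (x + t n *: h n) - f x - t n *: A h0)) @ \oo
        --> (0 : Y).

End Differentiability.

Section Germs.
Context {R : realType} {X Y : topologicalLmodType R}.

(* A map into [Y] defined on a neighborhood [lm_dom] of 0; the values of
   [lm_fun] outside [lm_dom] are irrelevant. *)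
Record local_map := LocalMap {
  lm_dom : set X ;
  lm_fun :> X -> Y ;
  lm_nbhs : nbhs 0 lm_dom }.

Definition germ_eq (f g : local_map) : Prop :=
  exists U : set X, [/\ nbhs 0 U, U `<=` lm_dom f, U `<=` lm_dom g &
    forall x, U x -> f x = g x].

Record germ := Germ {
  representatives :> set local_map ;
  germP : exists f, representatives = [set g | germ_eq f g] }.

Definition differentiable_on (diff_at : (X -> Y) -> X -> Prop)
    (f : local_map) (U : set X) : Prop :=
  forall x, U x -> nbhs x (lm_dom f) /\ diff_at f x.

Definition differentiable_germ (diff_at : (X -> Y) -> X -> Prop)
    (g : germ) : Prop :=
  exists f, representatives g f /\
    exists U : set X, nbhs 0 U /\ differentiable_on diff_at f U.

Definition has_global_representative (diff_at : (X -> Y) -> X -> Prop)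
    (g : germ) : Prop :=
  exists f, [/\ representatives g f, lm_dom f = setT &
    differentiable_on diff_at f setT].

End Germs.
Arguments local_map {R} X Y.
Arguments germ {R} X Y.

Definition CR (R : realType) : Type := continuousType R R.

Section ContinuousFunctions.
Variable R : realType.
Implicit Types x y z : CR R.

HB.instance Definition _ := Choice.on (CR R).

Definition CR_fun x : R -> R := x.

Lemma CR_cts x : continuous (CR_fun x).
Proof. exact: cts_fun. Qed.

Lemma CR_eqP x y : CR_fun x =1 CR_fun y -> x = y.
Proof. by move=> xy; apply/continuousEP. Qed.

Definition CR_of (f : R -> R) (cf : continuous f) : CR R := mkcts cf.

Lemma CR_add_cts x y : continuous (fun t => CR_fun x t + CR_fun y t).
Proof. by move=> t; apply: cvgD; exact: CR_cts. Qed.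

Lemma CR_opp_cts x : continuous (fun t => - CR_fun x t).
Proof. by move=> t; apply: cvgN; exact: CR_cts. Qed.

Lemma CR_scale_cts (a : R) x : continuous (fun t => a * CR_fun x t).
Proof. by move=> t; apply: cvgM; [exact: cvg_cst|exact: CR_cts]. Qed.

Lemma CR_zero_cts : continuous (fun _ : R => 0 : R).
Proof. by move=> t; exact: cvg_cst. Qed.

Definition CR_add x y : CR R := CR_of (@CR_add_cts x y).
Definition CR_opp x : CR R := CR_of (@CR_opp_cts x).
Definition CR_scale (a : R) x : CR R := CR_of (@CR_scale_cts a x).
Definition CR_zero : CR R := CR_of CR_zero_cts.

Lemma CR_addA : associative CR_add.
Proof. by move=> x y z; apply: CR_eqP => t; exact: addrA. Qed.
Lemma CR_addC : commutative CR_add.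
Proof. by move=> x y; apply: CR_eqP => t; exact: addrC. Qed.
Lemma CR_add0 : left_id CR_zero CR_add.
Proof. by move=> x; apply: CR_eqP => t; exact: add0r. Qed.
Lemma CR_addN : left_inverse CR_zero CR_opp CR_add.
Proof. by move=> x; apply: CR_eqP => t; exact: addNr. Qed.

HB.instance Definition _ :=
  GRing.isZmodule.Build (CR R) CR_addA CR_addC CR_add0 CR_addN.

Lemma CR_scaleA (a b : R) x : CR_scale a (CR_scale b x) = CR_scale (a * b) x.
Proof. by apply: CR_eqP => t; exact: mulrA. Qed.
Lemma CR_scale1 : left_id 1 CR_scale.
Proof. by move=> x; apply: CR_eqP => t; exact: mul1r. Qed.
Lemma CR_scaleDr : right_distributive CR_scale +%R.
Proof. by move=> a x y; apply: CR_eqP => t; exact: mulrDr. Qed.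
Lemma CR_scaleDl x : {morph CR_scale^~ x : a b / a + b}.
Proof. by move=> a b; apply: CR_eqP => t; exact: mulrDl. Qed.

HB.instance Definition _ :=
  GRing.Zmodule_isLmodule.Build R (CR R) CR_scaleA CR_scale1 CR_scaleDr
    CR_scaleDl.

(* The sup is a max: [`|x|] is continuous and the interval is compact. *)
Definition CR_seminorm (k : nat) x : R :=
  sup [set `|CR_fun x t| | t in `[- k%:R, k%:R]%classic].

Lemma CR_has_sup k x : has_sup [set `|CR_fun x t| | t in `[- k%:R, k%:R]%classic].
Proof.
split.
  by exists `|CR_fun x 0|, 0 => //=; rewrite in_itv/= oppr_le0 ler0n.
have /compact_bounded[M [_ HM]] :
    compact [set CR_fun x t | t in `[- k%:R, k%:R]%classic].
  apply: continuous_compact; last exact: segment_compact.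
  by apply: continuous_subspaceT; exact: CR_cts.
exists (M + 1) => _ [t kt <-].
by apply: (HM (M + 1)); [rewrite ltrDl|exists t].
Qed.

Lemma CR_seminorm_ub k x t : t \in `[- k%:R, k%:R] ->
  `|CR_fun x t| <= CR_seminorm k x.
Proof. by move=> kt; apply: ub_le_sup; [case: (CR_has_sup k x)|exists t]. Qed.

Lemma CR_seminorm_le k x (e : R) :
  (forall t, t \in `[- k%:R, k%:R] -> `|CR_fun x t| <= e) ->
  CR_seminorm k x <= e.
Proof.
move=> xe; apply: ge_sup; first by case: (CR_has_sup k x).
by move=> _ [t kt <-]; exact: xe.
Qed.

Lemma CR_seminorm_ge0 k x : 0 <= CR_seminorm k x.
Proof.
apply: (le_trans (normr_ge0 (CR_fun x 0))); apply: CR_seminorm_ub.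
by rewrite in_itv/= oppr_le0 ler0n.
Qed.

Lemma CR_seminorm0 k : CR_seminorm k 0 = 0.
Proof.
apply/eqP; rewrite eq_le CR_seminorm_ge0 andbT.
by apply: CR_seminorm_le => t _; rewrite normr0.
Qed.

Lemma CR_seminormD k x y :
  CR_seminorm k (x + y) <= CR_seminorm k x + CR_seminorm k y.
Proof.
apply: CR_seminorm_le => t kt; apply: le_trans (ler_normD _ _) _.
by apply: lerD; exact: CR_seminorm_ub.
Qed.

Lemma CR_seminormZ k (a : R) x :
  CR_seminorm k (a *: x) <= `|a| * CR_seminorm k x.
Proof.
apply: CR_seminorm_le => t kt; rewrite [leLHS]normrM.
by apply: ler_wpM2l => //; exact: CR_seminorm_ub.
Qed.

Definition CR_ball x (s : seq nat) (e : R) : set (CR R) :=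
  [set y | forall k, k \in s -> CR_seminorm k (y - x) < e].

Definition CR_nbhs x : set_system (CR R) :=
  [set A | exists s : seq nat, exists2 e : R, 0 < e & CR_ball x s e `<=` A].

Lemma CR_nbhs_filter x : ProperFilter (CR_nbhs x).
Proof.
split.
  move=> [s [e e0 /(_ x)]]; apply => k _.
  by rewrite subrr CR_seminorm0.
split.
- by exists [::], 1.
- move=> A B [s [e e0 sA]] [s' [e' e'0 sB]].
  exists (s ++ s'), (Num.min e e'); first by rewrite lt_min e0.
  move=> y Hy; split.
    apply: sA => k ks; have := Hy k; rewrite mem_cat ks => /(_ isT).
    by rewrite lt_min => /andP[].
  apply: sB => k ks; have := Hy k; rewrite mem_cat ks orbT => /(_ isT).
  by rewrite lt_min => /andP[].
- by move=> A B AB [s [e e0 sA]]; exists s, e => //; exact: subset_trans AB.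
Qed.

Lemma CR_nbhs_singleton x (A : set (CR R)) : CR_nbhs x A -> A x.
Proof.
by move=> [s [e e0]]; apply => k _; rewrite subrr CR_seminorm0.
Qed.

Lemma CR_nbhs_nbhs x (A : set (CR R)) :
  CR_nbhs x A -> CR_nbhs x (CR_nbhs^~ A).
Proof.
move=> [s [e e0 sA]]; exists s, (e / 2); first by rewrite divr_gt0.
move=> y Hy; exists s, (e / 2); first by rewrite divr_gt0.
move=> z Hz; apply: sA => k ks.
rewrite -(subrK y z) -addrA [ltRHS]splitr.
apply: le_lt_trans (CR_seminormD _ _ _) _.
by apply: ltrD; [exact: Hz|exact: Hy].
Qed.

HB.instance Definition _ := hasNbhs.Build (CR R) CR_nbhs.
HB.instance Definition _ := Nbhs_isNbhsTopological.Build (CR R)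
  CR_nbhs_filter CR_nbhs_singleton CR_nbhs_nbhs.

Lemma CR_add_continuous : continuous (fun u : CR R * CR R => u.1 + u.2).
Proof.
move=> [x y] A [s [e e0 sA]].
exists (CR_ball x s (e / 2), CR_ball y s (e / 2)) => /=.
  by split; exists s, (e / 2) => //; rewrite divr_gt0.
move=> [x' y'] /= [Hx Hy]; apply: sA => k ks /=.
rewrite opprD addrACA [ltRHS]splitr.
apply: le_lt_trans (CR_seminormD _ _ _) _.
by apply: ltrD; [exact: Hx|exact: Hy].
Qed.

Lemma CR_seminorm_bound (s : seq nat) x :
  exists2 M : R, 0 < M & forall k, k \in s -> CR_seminorm k x <= M.
Proof.
elim: s => [|k s [M M0 HM]]; first by exists 1.
exists (M + CR_seminorm k x); first by rewrite ltr_wpDr// CR_seminorm_ge0.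
move=> j; rewrite inE => /orP[/eqP->|/HM jM]; first by rewrite lerDr ltW.
by rewrite (le_trans jM)// lerDl CR_seminorm_ge0.
Qed.

Lemma CR_scale_continuous : continuous (fun u : R^o * CR R => u.1 *: u.2).
Proof.
move=> [a x] A [s [e e0 sA]].
have [M M0 HM] := CR_seminorm_bound s x.
have a0 : 0 < `|a| + 1 by rewrite ltr_wpDl.
pose d := Num.min 1 (e / 2 / M).
have d0 : 0 < d by rewrite lt_min ltr01 !divr_gt0.
exists (ball (a : R^o) d, CR_ball x s (e / 2 / (`|a| + 1))) => /=.
  split; first exact: nbhsx_ballx.
  by exists s, (e / 2 / (`|a| + 1)) => //; rewrite !divr_gt0.
move=> [b y] /= [ab Hy]; apply: sA => k ks /=.
have {}ab : `|b - a| < d by move: ab; rewrite -ball_normE/= distrC.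
rewrite -(subrK (b *: x) (b *: y)) -addrA -scalerBr -scalerBl [ltRHS]splitr.
apply: le_lt_trans (CR_seminormD _ _ _) _; apply: ltr_leD.
  apply: le_lt_trans (CR_seminormZ _ _ _) _.
  have b1 : `|b| <= `|a| + 1.
    rewrite -(subrK a b) addrC (le_trans (ler_normD _ _))// lerD2l.
    by apply: ltW; apply: lt_le_trans ab _; rewrite ge_min lexx.
  apply: (@le_lt_trans _ _ ((`|a| + 1) * CR_seminorm k (y - x))).
    by rewrite ler_wpM2r// CR_seminorm_ge0.
  by rewrite mulrC -ltr_pdivlMr//; exact: Hy.
apply: le_trans (CR_seminormZ _ _ _) _.
apply: (@le_trans _ _ (`|b - a| * M)); first by rewrite ler_wpM2l// HM.
rewrite -ler_pdivlMr//; apply: ltW; apply: lt_le_trans ab _.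
by rewrite ge_min lexx orbT.
Qed.

HB.instance Definition _ :=
  PreTopologicalNmodule_isTopologicalNmodule.Build (CR R) CR_add_continuous.
HB.instance Definition _ :=
  TopologicalNmodule_isTopologicalLmodule.Build R (CR R) CR_scale_continuous.

End ContinuousFunctions.

(* Main.v *)
Require Import Defs.
From HB Require Import structures.
From mathcomp Require Import all_boot all_order all_algebra.
From mathcomp Require Import all_classical all_reals all_analysis.
From mathcomp Require Import ring lra.

Set Implicit Arguments.
Unset Strict Implicit.
Unset Printing Implicit Defensive.

Import Order.TTheory GRing.Theory Num.Theory.
Import numFieldNormedType.Exports.

Local Open Scope classical_set_scope.
Local Open Scope ring_scope.

(** A germ cannot be extended by cutting it off: continuous functions on an
interval, with the sup norm, carry no Frechet differentiable bump function.
Instead the germ is composed with a map [saturate] from [CR R] to itself that is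
everywhere differentiable, is the identity near 0, and takes all its values in
the neighborhood [U] of 0 on which the given representative [f] is
differentiable.  Then [f \o saturate] is a global representative, by the chain
rule ([global_representative]).

Such a map exists because the topology is so weak: [U] contains a set
[CR_seminorm k x < e], which restricts [x] on [[-k, k]] only.  With
[s + sat_corr a s] a scalar function that is the identity on [[-a, a]] and has
values in [[-3a/2, 3a/2]], where [a = e/2], the map applies this function to
[x t] for [t] in [[-k, k]]; outside this interval the correction is frozen at its
value at the nearer endpoint, so that the result stays continuous:
[saturate x t = x t + sat_corr a (x (clamp t))].  It is the identity as soon as
[CR_seminorm k x <= a], which holds on a neighborhood of 0.

The scalar correction has a Lipschitz derivative, so its first-order remainder
is at most [2/a * h^2].  This is uniform in the base point, hence passes to
[saturate]: every seminorm of its remainder at [h] is at most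
[2/a * (CR_seminorm k h)^2].  A quadratic remainder of this kind gives
differentiability in both senses ([quadratic_bounded_differentiable],
[quadratic_compact_differentiable]). *)

(** * Chain rules in topological vector spaces *)

Section ChainRule.
Context {R : realType} {X Y Z : topologicalLmodType R}.

Lemma nbhs0D (V : set Z) : nbhs 0 V ->
  exists2 W : set Z, nbhs 0 W & forall u v, W u -> W v -> V (u + v).
Proof.
move=> V0; have := @add_continuous Z (0, 0) V.
rewrite /= addr0 => /(_ V0) [[W1 W2] /= [W10 W20] W12].
exists (W1 `&` W2); first exact: filterI.
by move=> u v [u1 _] [_ v2]; exact: (W12 (u, v)).
Qed.

Lemma comp_linear_continuous (A : {linear Y -> Z}) (B : {linear X -> Y}) :
  continuous A -> continuous B -> continuous (A \o B : X -> Z).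
Proof. by move=> cA cB x; apply: continuous_comp; [exact: cB|exact: cA]. Qed.

(** If [h n] tends to [h0], the difference quotients of [phi] along [t n] and
[h n] tend to [B h0]; they are the directions along which the differentiability
of [f] at [phi x] is used. *)
Lemma compact_differentiable_comp (phi : X -> Y) (f : Y -> Z) (x : X) :
  compact_differentiable_at phi x -> compact_differentiable_at f (phi x) ->
  compact_differentiable_at (f \o phi) x.
Proof.
move=> [B [cB dphi]] [A [cA df]]; exists (A \o B); split.
  exact: comp_linear_continuous.
move=> t h h0 t0 hh0.
pose q n := (t n)^-1 *: (phi (x + t n *: h n) - phi x - t n *: B h0).
(* The direction is [q n + B h0] rather than the difference quotient itself:
   the two agree where [t n] is nonzero, and this one still converges when
   [t n] vanishes for some [n]. *)
have kB : (fun n => q n + B h0) @ \oo --> B h0.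
  rewrite -[X in _ --> X]add0r.
  apply: (@continuous2_cvg _ _ _ _ _ _ q (fun=> B h0) (@GRing.add Y)).
  - exact: (@add_continuous Y (0, B h0)).
  - exact: dphi.
  - exact: cvg_cst.
have phiE n : phi (x + t n *: h n) = phi x + t n *: (q n + B h0).
  have [tn0|tn0] := eqVneq (t n) 0; first by rewrite tn0 !scale0r !addr0.
  by rewrite scalerDr /q scalerA mulfV// scale1r subrK subrKC.
have := df t _ _ t0 kB; apply: cvg_trans; apply: near_eq_cvg.
by near=> n; rewrite /= phiE.
Unshelve. all: by end_near. Qed.

(** Bounded differentiability of [f] is uniform only over a bounded set of
directions, and here the directions are the difference quotients of [phi];
hence the hypothesis that for small [t] they stay in one bounded set. *)
Lemma bounded_differentiable_comp (phi : X -> Y) (f : Y -> Z) (x : X) :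
  bounded_differentiable_at phi x ->
  (forall S : set X, tvs_bounded S -> exists2 S' : set Y, tvs_bounded S' &
    \forall t \near (0 : R)^', forall h, S h ->
      S' (t^-1 *: (phi (x + t *: h) - phi x))) ->
  bounded_differentiable_at f (phi x) ->
  bounded_differentiable_at (f \o phi) x.
Proof.
move=> [B [cB dphi]] incr [A [cA df]]; exists (A \o B); split.
  exact: comp_linear_continuous.
move=> S bS V V0; have [W W0 WV] := nbhs0D V0.
have [S' bS' incrS] := incr S bS.
have AW : nbhs 0 (A @^-1` W) by apply: cA; rewrite linear0.
near=> t => h Sh.
have t0 : t != 0 by near: t; exact: nbhs_dnbhs_neq.
pose k := t^-1 *: (phi (x + t *: h) - phi x).
have phiE : phi (x + t *: h) = phi x + t *: k.
  by rewrite /k scalerA mulfV// scale1r subrKC.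
have -> : t^-1 *: remainder (f \o phi) (A \o B) x (t *: h) =
    t^-1 *: remainder f A (phi x) (t *: k) +
    A (t^-1 *: remainder phi B x (t *: h)).
  rewrite [A (t^-1 *: _)]linearZZ -scalerDr /remainder /= phiE.
  congr (_ *: _); rewrite !linearB linearD.
  by rewrite [A (phi x) + _]addrC addrK addrA subrK.
apply: WV; last by move: h Sh {k phiE}; near: t; exact: (dphi S bS _ AW).
have S'k : S' k by rewrite /k; move: h Sh {k phiE}; near: t; exact: incrS.
by move: k S'k {phiE}; near: t; exact: (df S' bS' W W0).
Unshelve. all: by end_near. Qed.

End ChainRule.

(** * A scalar saturation with Lipschitz derivative *)

Section Saturation.
Context {R : realType}.
Implicit Types a s h : R.

(** The function [s + sat_corr a s] is odd, with slope 1 on [[0, a]], slope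
decreasing linearly from 1 to 0 on [[a, 2a]], and slope 0 afterwards, where its
value is [3a/2].  It is written with squared positive parts, which turns the
remainder estimate into a sum of four copies of one elementary inequality. *)
Definition sat_corr a s : R :=
  (Num.max (s - 2 * a) 0 ^+ 2 - Num.max (s - a) 0 ^+ 2
   + Num.max (- s - a) 0 ^+ 2 - Num.max (- s - 2 * a) 0 ^+ 2) / (2 * a).

Definition dsat_corr a s : R :=
  (Num.max (s - 2 * a) 0 - Num.max (s - a) 0
   - Num.max (- s - a) 0 + Num.max (- s - 2 * a) 0) / a.

Lemma pos_part_sqr_expansion s h :
  `|Num.max (s + h) 0 ^+ 2 - Num.max s 0 ^+ 2 - 2 * Num.max s 0 * h| <= h ^+ 2.
Proof.
rewrite ler_norml.
by case: (lerP (s + h) 0) => ?; case: (lerP s 0) => ?; apply/andP; split; nra.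
Qed.

Lemma sat_corr_expansion a s h : 0 < a ->
  `|sat_corr a (s + h) - sat_corr a s - dsat_corr a s * h| <= 2 / a * h ^+ 2.
Proof.
move=> a0.
have := pos_part_sqr_expansion (s - 2 * a) h.
have := pos_part_sqr_expansion (s - a) h.
have := pos_part_sqr_expansion (- s - a) (- h).
have := pos_part_sqr_expansion (- s - 2 * a) (- h).
rewrite /sat_corr /dsat_corr.
rewrite (_ : - s - 2 * a - h = - (s + h) - 2 * a); last by ring.
rewrite (_ : - s - a - h = - (s + h) - a); last by ring.
rewrite (_ : s - 2 * a + h = s + h - 2 * a); last by ring.
rewrite (_ : s - a + h = s + h - a); last by ring.
set p1 := Num.max (s + h - 2 * a) 0; set p2 := Num.max (s + h - a) 0.
set p3 := Num.max (- (s + h) - a) 0; set p4 := Num.max (- (s + h) - 2 * a) 0.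
set q1 := Num.max (s - 2 * a) 0; set q2 := Num.max (s - a) 0.
set q3 := Num.max (- s - a) 0; set q4 := Num.max (- s - 2 * a) 0.
rewrite sqrrN => H4 H3 H2 H1.
have -> : (p1 ^+ 2 - p2 ^+ 2 + p3 ^+ 2 - p4 ^+ 2) / (2 * a) -
    (q1 ^+ 2 - q2 ^+ 2 + q3 ^+ 2 - q4 ^+ 2) / (2 * a) -
    (q1 - q2 - q3 + q4) / a * h =
  ((p1 ^+ 2 - q1 ^+ 2 - 2 * q1 * h) - (p2 ^+ 2 - q2 ^+ 2 - 2 * q2 * h)
   + (p3 ^+ 2 - q3 ^+ 2 - 2 * q3 * - h) - (p4 ^+ 2 - q4 ^+ 2 - 2 * q4 * - h))
   / (2 * a) by field; rewrite gt_eqF.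
have -> : 2 / a * h ^+ 2 = 4 * h ^+ 2 / (2 * a) by field; rewrite gt_eqF.
rewrite normrM [`|_^-1|]gtr0_norm ?invr_gt0 ?mulr_gt0//.
rewrite ler_pM2r ?invr_gt0 ?mulr_gt0//.
move: H1 H2 H3 H4; rewrite !ler_norml.
by move=> /andP[? ?] /andP[? ?] /andP[? ?] /andP[? ?]; apply/andP; split; lra.
Qed.

Lemma dsat_corr_le1 a s : 0 < a -> `|dsat_corr a s| <= 1.
Proof.
move=> a0; rewrite /dsat_corr normrM [`|_^-1|]gtr0_norm ?invr_gt0//.
rewrite ler_pdivrMr// mul1r ler_norml.
by case: (lerP (s - 2 * a) 0); case: (lerP (s - a) 0);
  case: (lerP (- s - a) 0); case: (lerP (- s - 2 * a) 0) => *;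
  apply/andP; split; lra.
Qed.

Lemma sat_corr_eq0 a s : `|s| <= a -> sat_corr a s = 0.
Proof.
move=> sa; have := le_trans (normr_ge0 _) sa; move: sa.
rewrite ler_norml => /andP[? ?] ?; rewrite /sat_corr.
by rewrite !max_r ?expr0n /= ?subrr ?addr0 ?subr0 ?mul0r//; lra.
Qed.

Lemma saturation_bound a s : 0 < a -> `|s + sat_corr a s| <= 3 / 2 * a.
Proof.
move=> a0; rewrite /sat_corr.
set N := (X in X / (2 * a)).
have -> : s + N / (2 * a) = (2 * a * s + N) / (2 * a) by field; rewrite gt_eqF.
rewrite normrM [`|_^-1|]gtr0_norm ?invr_gt0 ?mulr_gt0//.
rewrite ler_pdivrMr ?mulr_gt0// ler_norml /N.
by case: (lerP (s - 2 * a) 0); case: (lerP (s - a) 0);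
  case: (lerP (- s - a) 0); case: (lerP (- s - 2 * a) 0) => *;
  apply/andP; split; nra.
Qed.

Lemma pos_part_continuous (u : R -> R) : continuous u ->
  continuous (fun s => Num.max (u s) 0).
Proof.
by move=> cu; apply: max_fun_continuous => // x; exact: cvg_cst.
Qed.

Lemma sat_corr_continuous a : continuous (sat_corr a).
Proof.
have cp (u : R -> R) : continuous u ->
    continuous (fun s => Num.max (u s) 0 ^+ 2).
  by move=> cu x; apply: (@cvgM R); exact: pos_part_continuous.
have c1 (b : R) : continuous (fun s : R => s - b).
  by move=> x; apply: cvgB; [exact: cvg_id|exact: cvg_cst].
have c2 (b : R) : continuous (fun s : R => - s - b).
  by move=> x; apply: cvgB; [apply: cvgN; exact: cvg_id|exact: cvg_cst].
move=> x; apply: cvgMl.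
apply: cvgB; last exact: (cp _ (c2 (2 * a))).
apply: cvgD; last exact: (cp _ (c2 a)).
by apply: cvgB; [exact: (cp _ (c1 (2 * a)))|exact: (cp _ (c1 a))].
Qed.

Lemma dsat_corr_continuous a : continuous (dsat_corr a).
Proof.
have c1 (b : R) : continuous (fun s : R => s - b).
  by move=> x; apply: cvgB; [exact: cvg_id|exact: cvg_cst].
have c2 (b : R) : continuous (fun s : R => - s - b).
  by move=> x; apply: cvgB; [apply: cvgN; exact: cvg_id|exact: cvg_cst].
move=> x; apply: cvgMl.
apply: cvgD; last exact: (pos_part_continuous (c2 (2 * a))).
apply: cvgB; last exact: (pos_part_continuous (c2 a)).
apply: cvgB; first exact: (pos_part_continuous (c1 (2 * a))).
exact: (pos_part_continuous (c1 a)).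
Qed.

End Saturation.

(** * Differentiability from a quadratic remainder *)

Section SeminormCalculus.
Context {R : realType}.
Implicit Types (x h : CR R) (S : set (CR R)).

Lemma CR_funD x h t : CR_fun (x + h) t = CR_fun x t + CR_fun h t.
Proof. by []. Qed.

Lemma CR_funN x t : CR_fun (- x) t = - CR_fun x t.
Proof. by []. Qed.

Lemma CR_funZ (c : R) x t : CR_fun (c *: x) t = c * CR_fun x t.
Proof. by []. Qed.

Lemma CR_ofE (f : R -> R) (cf : continuous f) t : CR_fun (CR_of cf) t = f t.
Proof. by []. Qed.

Lemma CR_ball_nbhs x s (e : R) : 0 < e -> nbhs x (CR_ball x s e).
Proof. by move=> e0; exists s, e. Qed.

Lemma CR_seminorm_mono j k x : (j <= k)%N -> CR_seminorm j x <= CR_seminorm k x.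
Proof.
move=> jk; apply: CR_seminorm_le => t; rewrite in_itv /= => /andP[jt tj].
have : j%:R <= k%:R :> R by rewrite ler_nat.
by move=> ?; apply: CR_seminorm_ub; rewrite in_itv /=; apply/andP; split; lra.
Qed.

Lemma CR_tvs_boundedP S : tvs_bounded S <->
  forall k, exists M, forall x, S x -> CR_seminorm k x <= M.
Proof.
split=> [bS k|bS V [s [e e0 sV]]].
  have B1 : nbhs 0 (CR_ball (0 : CR R) [:: k] 1) by exact: CR_ball_nbhs.
  have [t [t0 tS]] : exists t, 0 < t /\ S `<=` ( *:%R t) @` 
    CR_ball (0 : CR R) [:: k] 1.
    near (pinfty_nbhs R) => t; exists t; split; near: t.
      exact: nbhs_pinfty_gt.
    exact: bS.
  exists t => x /tS [y /(_ k)]; rewrite subr0 inE eqxx => /(_ isT) yk <-.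
  apply: le_trans (CR_seminormZ _ _ _) _; rewrite gtr0_norm//.
  by rewrite ler_piMr ?ltW.
have [M M0 HM] : exists2 M : R, 0 < M &
    forall x, S x -> forall k, k \in s -> CR_seminorm k x <= M.
  elim: s {sV} => [|k s [M M0 HM]]; first by exists 1.
  have [N HN] := bS k; exists (M + `|N|); first by rewrite ltr_wpDr.
  move=> x Sx j; rewrite inE => /orP[/eqP->|js].
    by rewrite (le_trans (HN x Sx))// (le_trans (ler_norm N))// lerDr ltW.
  by rewrite (le_trans (HM x Sx j js))// lerDl.
near=> t => x Sx.
have t0 : 0 < t by near: t; exact: nbhs_pinfty_gt.
have tM : M / e < t by near: t; exact: nbhs_pinfty_gt (num_real _).
exists (t^-1 *: x); last by rewrite scalerA mulfV ?scale1r// gt_eqF.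
apply: sV => k ks; rewrite subr0; apply: le_lt_trans (CR_seminormZ _ _ _) _.
rewrite gtr0_norm ?invr_gt0// mulrC ltr_pdivrMr// mulrC -ltr_pdivrMr//.
by apply: le_lt_trans tM; rewrite ler_pM2r ?invr_gt0// HM.
Unshelve. all: by end_near. Qed.

(** The index [k] is the same for all seminorms [CR_seminorm j]: the nonlinear
part of [phi] is controlled by values on the fixed interval [[-k, k]]. *)
Section QuadraticRemainder.
Variables (phi : CR R -> CR R) (B : {linear CR R -> CR R}) (x : CR R).
Variables (k : nat) (C : R).
Hypothesis C_ge0 : 0 <= C.
Hypothesis B_le : forall j h,
  CR_seminorm j (B h) <= CR_seminorm j h + CR_seminorm k h.
Hypothesis remainder_le : forall j h,
  CR_seminorm j (remainder phi B x h) <= C * CR_seminorm k h ^+ 2.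

Lemma dominated_linear_continuous : continuous B.
Proof.
move=> y V [s [e e0 sV]]; exists (k :: s), (e / 2); first by rewrite divr_gt0.
move=> z yz; apply: sV => j js; rewrite -linearB.
apply: le_lt_trans (B_le _ _) _; rewrite [ltRHS]splitr.
by apply: ltrD; apply: yz; rewrite inE ?eqxx// js orbT.
Qed.

(** The square provides the factor [`|t|] that is left after division by [t]. *)
Lemma remainder_quotient_le j (t : R) h :
  CR_seminorm j (t^-1 *: remainder phi B x (t *: h))
    <= C * `|t| * CR_seminorm k h ^+ 2.
Proof.
have [->|t0] := eqVneq t 0.
  by rewrite invr0 scale0r CR_seminorm0 normr0 mulr0 mul0r.
apply: le_trans (CR_seminormZ _ _ _) _.
rewrite normfV ler_pdivrMl ?normr_gt0//.
apply: le_trans (remainder_le _ _) _.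
rewrite (_ : `|t| * _ = C * (`|t| * CR_seminorm k h) ^+ 2); last by ring.
rewrite ler_wpM2l// lerXn2r ?nnegrE ?mulr_ge0 ?CR_seminorm_ge0//.
exact: CR_seminormZ.
Qed.

Lemma quadratic_bounded_differentiable : bounded_differentiable_at phi x.
Proof.
exists B; split; first exact: dominated_linear_continuous.
move=> S /CR_tvs_boundedP /(_ k) [M HM] V [s [e e0 sV]].
have M0 : 0 <= C * `|M| ^+ 2 by rewrite mulr_ge0 ?exprn_ge0.
near=> t => h Sh; apply: sV => j js; rewrite subr0.
apply: le_lt_trans (remainder_quotient_le _ _ _) _.
have hM : CR_seminorm k h <= `|M| by exact: le_trans (HM h Sh) (ler_norm _).
have te : `|t| < e / (C * `|M| ^+ 2 + 1).
  by near: t; apply: dnbhs0_lt; rewrite divr_gt0// ltr_wpDl.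
apply: (@le_lt_trans _ _ (`|t| * (C * `|M| ^+ 2))).
  rewrite [C * _]mulrC -mulrA ler_wpM2l// ler_wpM2l//.
  by rewrite lerXn2r ?nnegrE ?CR_seminorm_ge0.
move: te; rewrite ltr_pdivlMr ?ltr_wpDl// => te.
by apply: le_lt_trans te; rewrite ler_wpM2l// lerDl.
Unshelve. all: by end_near. Qed.

(** The difference quotient is [B h] plus the remainder quotient; for
[`|t| <= 1] both are bounded in every seminorm by bounds on [h]. *)
Lemma quadratic_bounded_increments S : tvs_bounded S ->
  exists2 S', tvs_bounded S' & \forall t \near (0 : R)^', forall h, S h ->
    S' (t^-1 *: (phi (x + t *: h) - phi x)).
Proof.
move=> /CR_tvs_boundedP bS.
exists [set y | exists t h, [/\ S h, t != 0, `|t| <= 1 &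
    y = t^-1 *: (phi (x + t *: h) - phi x)]]; last first.
  near=> t => h Sh; exists t, h; split=> //; near: t.
    exact: nbhs_dnbhs_neq.
  exact: dnbhs0_le.
apply/CR_tvs_boundedP => j; have [M HM] := bS j; have [N HN] := bS k.
exists (M + N + C * N ^+ 2) => _ [t [h [Sh t0 t1 ->]]].
have -> : phi (x + t *: h) - phi x = t *: B h + remainder phi B x (t *: h).
  by rewrite /remainder linearZZ subrKC.
rewrite scalerDr scalerA mulVf// scale1r.
apply: le_trans (CR_seminormD _ _ _) _; apply: lerD.
  by apply: le_trans (B_le _ _) _; apply: lerD; [exact: HM|exact: HN].
apply: le_trans (remainder_quotient_le _ _ _) _.
apply: ler_pM; rewrite ?mulr_ge0 ?exprn_ge0 ?CR_seminorm_ge0//.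
  by rewrite ler_piMr.
rewrite lerXn2r ?nnegrE ?CR_seminorm_ge0 ?HN//.
by apply: le_trans (HN h Sh); exact: CR_seminorm_ge0.
Unshelve. all: by end_near. Qed.

Lemma quadratic_compact_differentiable : compact_differentiable_at phi x.
Proof.
exists B; split; first exact: dominated_linear_continuous.
move=> t h h0 t0 hh0 V [s [e e0 sV]].
pose M := CR_seminorm k h0 + 1.
have M0 : 0 <= C * M ^+ 2 by rewrite mulr_ge0// exprn_ge0// addr_ge0// CR_seminorm_ge0.
have d0 : 0 < Num.min 1 (e / 4) by rewrite lt_min ltr01 divr_gt0.
have tn : \forall n \near \oo, `|t n| < e / 2 / (C * M ^+ 2 + 1).
  have : 0 < e / 2 / (C * M ^+ 2 + 1) by rewrite !divr_gt0// ltr_wpDl.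
  by move: (e / 2 / _) => d; exact: cvgr0_norm_lt t0 d.
have hn : \forall n \near \oo, CR_ball h0 (k :: s) (Num.min 1 (e / 4)) (h n).
  by apply: hh0; exact: CR_ball_nbhs.
apply: filterS2 tn hn => n tn hn; apply: sV => j js; rewrite subr0.
have [tn0|tn0] := eqVneq (t n) 0.
  by rewrite tn0 invr0 scale0r CR_seminorm0.
have -> : (t n)^-1 *: (phi (x + t n *: h n) - phi x - t n *: B h0) =
    B (h n - h0) + (t n)^-1 *: remainder phi B x (t n *: h n).
  rewrite -[B (_ - _)]scale1r -(mulVf tn0) -scalerA -scalerDr /remainder; congr (_ *: _).
  by rewrite linearB [B (t n *: _)]linearZZ scalerBr [RHS]addrC [RHS]addrA subrK.
have hk : CR_seminorm k (h n - h0) < Num.min 1 (e / 4).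
  by apply: hn; rewrite inE eqxx.
have hj : CR_seminorm j (h n - h0) < Num.min 1 (e / 4).
  by apply: hn; rewrite inE js orbT.
have hM : CR_seminorm k (h n) <= M.
  rewrite -(subrK h0 (h n)) /M addrC; apply: le_trans (CR_seminormD _ _ _) _.
  by rewrite lerD2l; move: hk; rewrite lt_min => /andP[/ltW].
apply: le_lt_trans (CR_seminormD _ _ _) _; rewrite [ltRHS]splitr.
apply: ltr_leD.
  apply: le_lt_trans (B_le _ _) _.
  by move: hk hj; rewrite !lt_min => /andP[_ ?] /andP[_ ?]; lra.
apply: le_trans (remainder_quotient_le _ _ _) _.
apply: (@le_trans _ _ (`|t n| * (C * M ^+ 2))).
  rewrite [C * _]mulrC -mulrA ler_wpM2l// ler_wpM2l//.
  by rewrite lerXn2r ?nnegrE ?CR_seminorm_ge0// (le_trans _ hM)// CR_seminorm_ge0.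
move: tn; rewrite ltr_pdivlMr ?ltr_wpDl// => /ltW; apply: le_trans.
by rewrite ler_wpM2l// lerDl.
Qed.

End QuadraticRemainder.
End SeminormCalculus.

(** * The saturation map into a neighborhood of zero *)

Section SaturationMap.
Context {R : realType}.
Variables (a : R) (k : nat).
Implicit Types (x h : CR R) (t : R).

Definition clamp t : R := Num.max (- k%:R) (Num.min k%:R t).

Lemma clamp_in t : clamp t \in `[- k%:R, k%:R].
Proof.
have k0 : 0 <= k%:R :> R by exact: ler0n.
rewrite in_itv /= /clamp le_max lexx /= ge_max ge_min lexx andbT.
by rewrite (le_trans _ k0)// oppr_le0.
Qed.

Lemma clamp_id t : t \in `[- k%:R, k%:R] -> clamp t = t.
Proof.
by rewrite in_itv /= /clamp => /andP[kt tk]; rewrite min_r// max_r.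
Qed.

Lemma clamp_continuous : continuous clamp.
Proof.
apply: max_fun_continuous => [t|]; first exact: cvg_cst.
by apply: min_fun_continuous => t; [exact: cvg_cst|exact: cvg_id].
Qed.

Lemma comp_clamp_continuous (u : R -> R) x : continuous u ->
  continuous (fun t => u (CR_fun x (clamp t))).
Proof.
move=> cu t; apply: (@continuous_comp _ _ _ (fun s => CR_fun x (clamp s)) u).
  by apply: continuous_comp; [exact: clamp_continuous|exact: CR_cts].
exact: cu.
Qed.

Lemma saturate_continuous x :
  continuous (fun t => CR_fun x t + sat_corr a (CR_fun x (clamp t))).
Proof.
move=> t; apply: cvgD; first exact: CR_cts.
by apply: comp_clamp_continuous; exact: sat_corr_continuous.
Qed.

Definition saturate x : CR R := CR_of (@saturate_continuous x).

Lemma dsaturate_continuous x h : continuous (fun t =>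
  CR_fun h t + dsat_corr a (CR_fun x (clamp t)) * CR_fun h (clamp t)).
Proof.
move=> t; apply: cvgD; first exact: CR_cts.
apply: cvgM; first by apply: comp_clamp_continuous; exact: dsat_corr_continuous.
by apply: continuous_comp; [exact: clamp_continuous|exact: CR_cts].
Qed.

Definition dsaturate x h : CR R := CR_of (@dsaturate_continuous x h).

Lemma dsaturate_is_linear x : linear (dsaturate x).
Proof.
move=> c u v; apply: CR_eqP => t.
by rewrite CR_ofE !(CR_funD, CR_funZ, CR_ofE); ring.
Qed.

HB.instance Definition _ x := GRing.isLinear.Build R (CR R) (CR R) *:%R
  (dsaturate x) (@dsaturate_is_linear x).

Hypothesis a_gt0 : 0 < a.

(** The clamped argument lies in [[-k, k]], whatever [t] is: this is what makes
the second term independent of [j]. *)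
Lemma dsaturate_le x j h :
  CR_seminorm j (dsaturate x h) <= CR_seminorm j h + CR_seminorm k h.
Proof.
apply: CR_seminorm_le => t jt; apply: le_trans (ler_normD _ _) _.
apply: lerD; first exact: CR_seminorm_ub.
apply: le_trans (CR_seminorm_ub h (clamp_in t)).
by rewrite normrM ler_piMl// dsat_corr_le1.
Qed.

Lemma saturate_remainder_le x j h :
  CR_seminorm j (remainder saturate (dsaturate x) x h)
    <= 2 / a * CR_seminorm k h ^+ 2.
Proof.
apply: CR_seminorm_le => t _.
rewrite /remainder !(CR_funD, CR_funN, CR_ofE).
set X := CR_fun x (clamp t); set H := CR_fun h (clamp t).
rewrite (_ : _ - _ = sat_corr a (X + H) - sat_corr a X - dsat_corr a X * H);
  last by ring.
apply: le_trans (sat_corr_expansion _ _ a_gt0) _.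
have a2 : 0 <= 2 / a by rewrite divr_ge0 ?ltW.
rewrite ler_wpM2l// -[H ^+ 2]real_normK ?num_real//.
by rewrite lerXn2r ?nnegrE ?CR_seminorm_ge0// CR_seminorm_ub// clamp_in.
Qed.

Lemma saturate_near0 x : CR_seminorm k x <= a -> saturate x = x.
Proof.
move=> xa; apply: CR_eqP => t; rewrite CR_ofE sat_corr_eq0 ?addr0//.
by apply: le_trans xa; rewrite CR_seminorm_ub// clamp_in.
Qed.

Lemma saturate_range x : CR_seminorm k (saturate x) <= 3 / 2 * a.
Proof.
apply: CR_seminorm_le => t kt.
by rewrite CR_ofE (clamp_id kt) saturation_bound.
Qed.

End SaturationMap.

(** * Global representatives *)

(** One argument serves every notion of differentiability at a point that
precomposition with [saturate] preserves. *)
Lemma global_representative (R : realType) (Y : topologicalLmodType R)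
  (diff_at : (CR R -> Y) -> CR R -> Prop) :
  (forall (f : CR R -> Y) (a : R) (k : nat) (x : CR R), 0 < a ->
    diff_at f (saturate a k x) -> diff_at (f \o saturate a k) x) ->
  forall g : germ (CR R) Y,
    differentiable_germ diff_at g -> has_global_representative diff_at g.
Proof.
move=> diff_comp g; have [f0 gE] := germP g; move=> [f []].
rewrite gE => [[W [W0 Wf0 Wf f0f]] [U [[s [e e0 sU]] dfU]]].
(* The neighborhood is given by finitely many seminorms; the largest index
   dominates them all. *)
pose k := (\max_(i <- s) i)%N.
have a0 : 0 < e / 2 by rewrite divr_gt0.
have rU x : U (saturate (e / 2) k x).
  apply: sU => j js; rewrite subr0.
  have jk : (j <= k)%N by exact: leq_bigmax_seq.
  apply: le_lt_trans (CR_seminorm_mono _ jk) _.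
  by apply: le_lt_trans (saturate_range k a0 _) _; lra.
exists (LocalMap (f \o saturate (e / 2) k) filterT); split=> //=.
  rewrite gE; exists (W `&` CR_ball 0 [:: k] (e / 2)); split=> //.
  - by apply: filterI => //; exact: CR_ball_nbhs.
  - by move=> x [/Wf0].
  move=> x [Wx /(_ k)]; rewrite inE eqxx subr0 => /(_ isT) /ltW xk /=.
  by rewrite saturate_near0// f0f.
move=> x _; split; first exact: filterT.
by apply: diff_comp => //; have [] := dfU _ (rU x).
Qed.

Theorem corollary5p3 (R : realType) (Y : topologicalLmodType R) :
  (forall g : germ (CR R) Y,
     differentiable_germ bounded_differentiable_at g ->
     has_global_representative bounded_differentiable_at g) /\
  (forall g : germ (CR R) Y,
     differentiable_germ compact_differentiable_at g ->
     has_global_representative compact_differentiable_at g).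
Proof.
split; apply: global_representative => f a k x a0;
  have C0 : 0 <= 2 / a by rewrite divr_ge0 ?ltW.
  apply: bounded_differentiable_comp.
    exact: quadratic_bounded_differentiable C0
      (dsaturate_le k a0 x) (saturate_remainder_le k a0 x).
  exact: quadratic_bounded_increments C0
    (dsaturate_le k a0 x) (saturate_remainder_le k a0 x).
apply: compact_differentiable_comp.
exact: quadratic_compact_differentiable C0
  (dsaturate_le k a0 x) (saturate_remainder_le k a0 x).
Qed.
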